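(* The following hold. (1) If $\mathcal{C}$ is a complex functor, then $\mathrm{Fix}(\mathcal{C})$ is a pseudovariety. (2) The map $\mathrm{Fix} : \mathbf{CF} \to \mathbf{PV}$ is antitone and takes joins in $\mathbf{CF}$ to intersections in $\mathbf{PV}$. Moreover, $\mathrm{Fix}(\mathcal{P}) = \mathbf{1}$ and $\mathrm{Fix}(\mathrm{sing}) = \mathsf{FSgp}$ (the class of all finite semigroups). (3) Consequently, $\mathrm{Fix}$ has an antitone upper adjoint $$\mathrm{Max} : \mathbf{PV}^{\mathrm{op}} \to \mathbf{CF}, \qquad \mathrm{Max}[\mathbf{V}] = \bigvee \{\, \mathcal{C} \in \mathbf{CF} : \mathbf{V} \subseteq \mathrm{Fix}(\mathcal{C}) \,\},$$ so that there is an antitone Galois connection between the complete lattices $\mathbf{CF}$ and $\mathbf{PV}$: for all $\mathcal{C} \in \mathbf{CF}$ and $\mathbf{V} \in \mathbf{PV}$, one has $\mathcal{C} \le \mathrm{Max}[\mathbf{V}]$ if and only if $\mathbf{V} \subseteq \mathrm{Fix}(\mathcal{C})$.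
   Context: $\mathsf{FSgp}$ is the category of finite semigroups (the empty semigroup is allowed) and homomorphisms; its monomorphisms are the injective homomorphisms and its regular epimorphisms are the surjective homomorphisms. For a finite semigroup $S$, $\mathcal{P}(S)$ is the semigroup of non-empty subsets of $S$ under $XY = \{xy : x\in X, y\in Y\}$, and $\mathrm{sing}(S) \subseteq \mathcal{P}(S)$ is the subsemigroup of singletons. A homomorphism $\varphi : S \to T$ extends to $\dot\varphi : \mathcal{P}(S) \to \mathcal{P}(T)$, $X \mapsto \{\varphi(x) : x \in X\}$. An $S$-complex is a subsemigroup $\mathcal{K}$ of $\mathcal{P}(S)$ which contains $\mathrm{sing}(S)$ and is closed under taking non-empty subsets of its members. The set of $S$-complexes is a complete lattice under inclusion with intersection as meet; the join of a family is the smallest $S$-complex containing all of its members. A complex functor is a functor $\mathcal{C} : \mathsf{FSgp} \to \mathsf{FSgp}$ such that $\mathcal{C}(S)$ is an $S$-complex for every finite semigroup $S$, $\mathcal{C}$ sends each homomorphism $\varphi : S \to T$ to the restriction $\dot\varphi : \mathcal{C}(S) \to \mathcal{C}(T)$, and $\mathcal{C}$ preserves regular epimorphisms. $\mathbf{CF}$ is the collection of complex functors, ordered by $\mathcal{C}_1 \le \mathcal{C}_2$ iff $\mathcal{C}_1(S) \subseteq \mathcal{C}_2(S)$ for all $S$; it is a complete lattice with joins computed pointwise in the lattices of $S$-complexes, top $\mathcal{P}$ and bottom $\mathrm{sing}$. For $\mathcal{C} \in \mathbf{CF}$, $\mathrm{Fix}(\mathcal{C}) = \{ S \in \mathsf{FSgp}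 : \mathcal{C}(S) = \mathrm{sing}(S) \}$. A pseudovariety is a class of finite semigroups closed under subsemigroups, homomorphic images and finite products. $\mathbf{PV}$ is the complete lattice of pseudovarieties under inclusion (meet is intersection). $\mathbf{1}$ is the trivial pseudovariety (semigroups with at most one element). *)

(* Defs.v *)
From HB Require Import structures.
From mathcomp Require Import all_boot.
From mathcomp Require Import boolp.

Set Implicit Arguments.
Unset Strict Implicit.
Unset Printing Implicit Defensive.

Local Open Scope group_scope.

(* The empty semigroup is allowed: neither structure has a distinguished
   element. *)
#[short(type="finSemigroupType")]
HB.structure Definition FinSemigroup := {G of Semigroup G & Finite G}.

Definition surj (A B : Type) (f : A -> B) : Prop := forall b, exists a, f a = b.

(* Direct product of a finite family; for an empty I this is the one-element
   semigroup. *)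
Section DirectProduct.
Variables (I : finType) (S : I -> finSemigroupType).

Definition prod_sgp := {dffun forall i : I, S i}.
HB.instance Definition _ := Finite.on prod_sgp.

Definition prod_mul (f g : prod_sgp) : prod_sgp := [ffun i => f i * g i].

Lemma prod_mulA : associative prod_mul.
Proof. by move=> f g h; apply/ffunP => i; rewrite !ffunE mulgA. Qed.

HB.instance Definition _ := isSemigroup.Build prod_sgp prod_mulA.
End DirectProduct.

Section Complexes.
Variable S : finSemigroupType.
Implicit Types (X Y : {set S}) (K : {set {set S}}).

Definition setmul X Y : {set S} := [set x * y | x in X, y in Y].

Lemma setmulA : associative setmul.
Proof.
move=> X Y Z; apply/setP => a; apply/imset2P/imset2P.
  case=> x _ Xx /imset2P[y z Yy Zz ->] ->.
  by exists (x * y) z => //; [apply/imset2P; exists x y | rewrite mulgA].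
case=> _ z /imset2P[x y Xx Yy ->] Zz ->.
by exists x (y * z) => //; [apply/imset2P; exists y z | rewrite mulgA].
Qed.

Lemma setmul_neq0 X Y : X != set0 -> Y != set0 -> setmul X Y != set0.
Proof.
case/set0Pn=> x Xx /set0Pn[y Yy]; apply/set0Pn; exists (x * y).
by apply/imset2P; exists x y.
Qed.

Definition powset : {set {set S}} := [set X | X != set0].

Definition sing : {set {set S}} := [set [set x] | x : S].

Record is_complex K : Prop := IsComplex {
  complex_pow : K \subset powset;
  complex_mul : forall X Y, X \in K -> Y \in K -> setmul X Y \in K;
  complex_sing : sing \subset K;
  complex_down : forall X Y, X \in K -> Y \subset X -> Y != set0 -> Y \in K
}.

Record scomplex := SComplex {
  complex_set :> {set {set S}};
  complexP : is_complex complex_set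
}.

Lemma powset_complex : is_complex powset.
Proof.
split=> [|X Y|| X Y _ _ Y0]; rewrite ?inE //; first exact: setmul_neq0.
apply/subsetP => _ /imsetP[x _ ->]; rewrite inE; apply/set0Pn; exists x.
by rewrite inE.
Qed.

Lemma sing_complex : is_complex sing.
Proof.
split=> [|_ _ /imsetP[x _ ->] /imsetP[y _ ->]|| _ Y /imsetP[x _ ->]].
- exact: complex_sing powset_complex.
- apply/imsetP; exists (x * y) => //.
  by rewrite /setmul imset2_set1l imset_set1.
- exact: subxx.
- rewrite subset1 => /orP[/eqP-> _|/eqP->]; last by rewrite eqxx.
  exact: imset_f.
Qed.

(* Smallest S-complex containing all members of F. *)
Definition join_set (F : scomplex -> Prop) : {set {set S}} :=
  [set X | `[< forall K : scomplex,
                 (forall L, F L -> complex_set L \subset K) -> X \in K >]].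

Lemma join_setP (F : scomplex -> Prop) X :
  reflect (forall K : scomplex,
             (forall L, F L -> complex_set L \subset K) -> X \in (K : {set _}))
          (X \in join_set F).
Proof. by rewrite inE; apply: asboolP. Qed.

Lemma join_complex (F : scomplex -> Prop) : is_complex (join_set F).
Proof.
split=> [|X Y /join_setP FX /join_setP FY||X Y /join_setP FX YX Y0].
- apply/subsetP => X /join_setP/(_ (SComplex powset_complex)); apply=> L _.
  exact: complex_pow (complexP L).
- apply/join_setP => K FK.
  by apply: (complex_mul (complexP K)); [apply: FX | apply: FY].
- apply/subsetP => X sX; apply/join_setP => K _.
  exact: (subsetP (complex_sing (complexP K))).
- apply/join_setP => K FK.
  exact: complex_down (complexP K) _ _ (FX K FK) YX Y0.
Qed.

Definition scomplex_join (F : scomplex -> Prop) : scomplex :=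
  SComplex (join_complex F).

Lemma scomplex_join_ub (F : scomplex -> Prop) (L : scomplex) :
  F L -> L \subset scomplex_join F.
Proof.
by move=> FL; apply/subsetP => X LX; apply/join_setP => K /(_ _ FL)/subsetP->.
Qed.

Lemma scomplex_join_le (F : scomplex -> Prop) (K : scomplex) :
  (forall L : scomplex, F L -> L \subset K) -> scomplex_join F \subset K.
Proof. by move=> FK; apply/subsetP => X /join_setP; apply. Qed.

End Complexes.

Arguments powset S : clear implicits.
Arguments sing S : clear implicits.

(* An S-complex as an object of the category of finite semigroups. *)
Section ComplexSemigroup.
Variables (S : finSemigroupType) (K : scomplex S).

Definition complex_sgp : Type := {X : {set S} | X \in complex_set K}.
HB.instance Definition _ := SubFinite.on complex_sgp.

Definition complex_sgp_mul (A B : complex_sgp) : complex_sgp :=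
  Sub (setmul (val A) (val B)) (complex_mul (complexP K) (valP A) (valP B)).

Lemma complex_sgp_mulA : associative complex_sgp_mul.
Proof. by move=> A B C; apply/val_inj; rewrite /= setmulA. Qed.

HB.instance Definition _ := isSemigroup.Build complex_sgp complex_sgp_mulA.
End ComplexSemigroup.

Lemma imset_setmul (S T : finSemigroupType) (phi : {multiplicative S -> T})
    (X Y : {set S}) :
  phi @: setmul X Y = setmul (phi @: X) (phi @: Y).
Proof.
apply/setP => b; apply/imsetP/imset2P.
  case=> _ /imset2P[x y Xx Yy ->] ->.
  by exists (phi x) (phi y); rewrite ?imset_f // gmulfM.
case=> _ _ /imsetP[x Xx ->] /imsetP[y Yy ->] ->.
by exists (x * y); [apply/imset2P; exists x y | rewrite gmulfM].
Qed.

(* cf_mapE says that cf_map phi is the restriction of X |-> phi @: X, which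
   determines it; the functor laws follow (cf_map_id and cf_map_comp). *)
Record complexFunctor := ComplexFunctor {
  cf_obj :> forall S : finSemigroupType, scomplex S;
  cf_map : forall S T : finSemigroupType, {multiplicative S -> T} ->
    {multiplicative complex_sgp (cf_obj S) -> complex_sgp (cf_obj T)};
  cf_mapE : forall (S T : finSemigroupType) (phi : {multiplicative S -> T})
    (A : complex_sgp (cf_obj S)), val (cf_map phi A) = phi @: val A;
  cf_surj : forall (S T : finSemigroupType) (phi : {multiplicative S -> T}),
    surj phi -> surj (cf_map phi)
}.

Lemma cf_map_id (C : complexFunctor) (S : finSemigroupType) :
  cf_map C (idfun : {multiplicative S -> S}) =1 id.
Proof. by move=> A; apply/val_inj; rewrite cf_mapE imset_id. Qed.

Lemma cf_map_comp (C : complexFunctor) (S T U : finSemigroupType)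
    (psi : {multiplicative T -> U}) (phi : {multiplicative S -> T}) :
  cf_map C (psi \o phi : {multiplicative S -> U})
    =1 cf_map C psi \o cf_map C phi.
Proof. by move=> A; apply/val_inj; rewrite /= !cf_mapE imset_comp. Qed.

Section MakeComplexFunctor.
Variable obj : forall S : finSemigroupType, scomplex S.
Hypothesis obj_map : forall (S T : finSemigroupType)
  (phi : {multiplicative S -> T}) X, X \in (obj S : {set _}) ->
  phi @: X \in (obj T : {set _}).
Hypothesis obj_surj : forall (S T : finSemigroupType)
  (phi : {multiplicative S -> T}), surj phi ->
  forall Y, Y \in (obj T : {set _}) ->
  exists2 X, X \in (obj S : {set _}) & phi @: X = Y.

Section Map.
Variables (S T : finSemigroupType) (phi : {multiplicative S -> T}).

Definition mkcf_fun (A : complex_sgp (obj S)) : complex_sgp (obj T) :=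
  Sub (phi @: val A) (obj_map phi (valP A)).

Lemma mkcf_funM : {morph mkcf_fun : A B / A * B}.
Proof. by move=> A B; apply/val_inj; rewrite /= imset_setmul. Qed.

HB.instance Definition _ := isMultiplicative.Build _ _ mkcf_fun mkcf_funM.
End Map.

Lemma mkcf_surj (S T : finSemigroupType) (phi : {multiplicative S -> T}) :
  surj phi -> surj (mkcf_fun phi).
Proof.
move=> sphi B; have [X KX XB] := obj_surj sphi (valP B).
by exists (Sub X KX); apply/val_inj.
Qed.

Definition mkcf : complexFunctor :=
  @ComplexFunctor obj (fun S T phi => mkcf_fun phi)
    (fun S T phi A => erefl) mkcf_surj.
End MakeComplexFunctor.

Lemma cf_imset (C : complexFunctor) (S T : finSemigroupType)
    (phi : {multiplicative S -> T}) X :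
  X \in (C S : {set _}) -> phi @: X \in (C T : {set _}).
Proof.
by move=> CX; have := valP (cf_map C phi (exist _ X CX)); rewrite cf_mapE.
Qed.

Lemma cf_imset_surj (C : complexFunctor) (S T : finSemigroupType)
    (phi : {multiplicative S -> T}) : surj phi ->
  forall Y, Y \in (C T : {set _}) ->
  exists2 X, X \in (C S : {set _}) & phi @: X = Y.
Proof.
move=> sphi Y CY; have [A AY] := cf_surj sphi (exist _ Y CY : complex_sgp (C T)).
by exists (val A); [exact: valP | rewrite -cf_mapE AY].
Qed.

Lemma imset_neq0 (S T : finType) (f : S -> T) (X : {set S}) :
  (f @: X != set0) = (X != set0).
Proof. by rewrite imset_eq0. Qed.

Lemma surj_imset_preim (S T : finType) (f : S -> T) (Y : {set T}) :
  surj f -> f @: (f @^-1: Y) = Y.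
Proof.
move=> sf; apply/setP => y; apply/imsetP/idP => [[x + ->]|Yy].
  by rewrite inE.
by have [x xy] := sf y; exists x; rewrite ?inE ?xy.
Qed.

Lemma pow_map (S T : finSemigroupType) (phi : {multiplicative S -> T}) X :
  X \in powset S -> phi @: X \in powset T.
Proof. by rewrite !inE imset_neq0. Qed.

Lemma pow_surj (S T : finSemigroupType) (phi : {multiplicative S -> T}) :
  surj phi -> forall Y, Y \in powset T ->
  exists2 X, X \in powset S & phi @: X = Y.
Proof.
move=> sphi Y; rewrite inE => Y0; exists (phi @^-1: Y).
  by rewrite inE -(imset_neq0 phi) surj_imset_preim.
exact: surj_imset_preim.
Qed.

Definition cf_pow : complexFunctor :=
  @mkcf (fun S => SComplex (powset_complex S)) pow_map pow_surj.

Lemma sing_map (S T : finSemigroupType) (phi : {multiplicative S -> T}) X :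
  X \in sing S -> phi @: X \in sing T.
Proof. by case/imsetP=> x _ ->; rewrite imset_set1 imset_f. Qed.

Lemma sing_surj (S T : finSemigroupType) (phi : {multiplicative S -> T}) :
  surj phi -> forall Y, Y \in sing T ->
  exists2 X, X \in sing S & phi @: X = Y.
Proof.
move=> sphi _ /imsetP[y _ ->]; have [x <-] := sphi y.
by exists [set x]; rewrite ?imset_f ?imset_set1.
Qed.

Definition cf_sing : complexFunctor :=
  @mkcf (fun S => SComplex (sing_complex S)) sing_map sing_surj.

Definition cf_le (C1 C2 : complexFunctor) : Prop :=
  forall S : finSemigroupType, C1 S \subset C2 S.

Section Join.
Variable F : complexFunctor -> Prop.

Definition join_obj (S : finSemigroupType) : scomplex S :=
  scomplex_join (fun K => exists2 C, F C & C S = K).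

Lemma join_map (S T : finSemigroupType) (phi : {multiplicative S -> T}) X :
  X \in (join_obj S : {set _}) -> phi @: X \in (join_obj T : {set _}).
Proof.
set K := [set X : {set S} | phi @: X \in complex_set (join_obj T)].
have inK Y : (Y \in K) = (phi @: Y \in complex_set (join_obj T)).
  by rewrite [LHS]in_set.
have jT := complexP (join_obj T).
have cK : is_complex K.
  split.
  - apply/subsetP => Y; rewrite inK => /(subsetP (complex_pow jT)).
    by rewrite !inE imset_neq0.
  - move=> Y Z; rewrite !inK imset_setmul; exact: (complex_mul jT).
  - apply/subsetP => Y sY; rewrite inK.
    exact/(subsetP (complex_sing jT))/sing_map.
  - move=> Y Z; rewrite !inK => jY ZY Z0.
    by apply: (complex_down jT jY); rewrite ?imsetS ?imset_neq0.
suff /subsetP H : join_obj S \subset SComplex cK by move/H; rewrite inK.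
apply: scomplex_join_le => _ [C FC <-]; apply/subsetP => Y CY.
rewrite inK; apply: (subsetP (scomplex_join_ub _)) (cf_imset phi CY).
by exists C.
Qed.

Lemma join_surj (S T : finSemigroupType) (phi : {multiplicative S -> T}) :
  surj phi -> forall Y, Y \in (join_obj T : {set _}) ->
  exists2 X, X \in (join_obj S : {set _}) & phi @: X = Y.
Proof.
move=> sphi Y jY; set K := [set phi @: (X : {set S}) | X : {set S} in complex_set (join_obj S)].
have jS := complexP (join_obj S).
have cK : is_complex K.
  split.
  - apply/subsetP => _ /imsetP[X jX ->]; rewrite inE imset_neq0.
    by move/(subsetP (complex_pow jS)): jX; rewrite inE.
  - move=> _ _ /imsetP[X jX ->] /imsetP[Z jZ ->].
    by rewrite -imset_setmul imset_f // (complex_mul jS).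
  - apply/subsetP => Z /(sing_surj sphi)[X sX <-].
    by rewrite imset_f // (subsetP (complex_sing jS)).
  - move=> _ Z /imsetP[X jX ->] ZX Z0.
    have ZE : phi @: (X :&: phi @^-1: Z) = Z.
      apply/setP => z; apply/imsetP/idP => [[x + ->]|Zz].
        by rewrite !inE => /andP[].
      have /imsetP[x Xx zx] := subsetP ZX z Zz.
      by exists x; rewrite // !inE Xx -zx.
    rewrite -ZE imset_f // (complex_down jS jX) ?subsetIl //.
    by rewrite -(imset_neq0 phi) ZE.
suff /subsetP/(_ Y jY)/imsetP[X jX ->] : join_obj T \subset SComplex cK.
  by exists X.
apply: scomplex_join_le => _ [C FC <-]; apply/subsetP => Z.
move=> /(cf_imset_surj sphi)[X CX <-]; apply: imset_f.
by apply: (subsetP (scomplex_join_ub _)) CX; exists C.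
Qed.

Definition cf_join : complexFunctor := mkcf join_map join_surj.

End Join.

Lemma cf_join_ub (F : complexFunctor -> Prop) C : F C -> cf_le C (cf_join F).
Proof. by move=> FC S; apply: scomplex_join_ub; exists C. Qed.

Lemma cf_join_le (F : complexFunctor -> Prop) D :
  (forall C, F C -> cf_le C D) -> cf_le (cf_join F) D.
Proof.
by move=> FD S; apply: scomplex_join_le => _ [C FC <-]; exact: FD.
Qed.

Lemma cf_le_pow C : cf_le C cf_pow.
Proof. by move=> S; exact: complex_pow (complexP (C S)). Qed.

Lemma cf_sing_le C : cf_le cf_sing C.
Proof. by move=> S; exact: complex_sing (complexP (C S)). Qed.

(* Plain predicates: finSemigroupType is too large for classical_sets.set. *)
Definition sgp_class := finSemigroupType -> Prop.

Definition class_le (V W : sgp_class) : Prop := forall S, V S -> W S.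

Definition Fix (C : complexFunctor) : sgp_class :=
  fun S => complex_set (C S) = sing S.

(* Subsemigroups are represented by injective homomorphisms, so that
   pseudovarieties are closed under isomorphism. Products of empty families
   are included. *)
Record is_pseudovariety (V : sgp_class) : Prop := IsPseudovariety {
  pv_sub : forall (S T : finSemigroupType) (f : {multiplicative T -> S}),
    injective f -> V S -> V T;
  pv_img : forall (S T : finSemigroupType) (f : {multiplicative S -> T}),
    surj f -> V S -> V T;
  pv_prod : forall (I : finType) (S : I -> finSemigroupType),
    (forall i, V (S i)) -> V (prod_sgp S)
}.

Record pseudovariety := Pseudovariety {
  pv_class :> sgp_class;
  pvP : is_pseudovariety pv_class
}.

Definition bigcap_class (I : Type) (F : I -> Prop) (V : I -> sgp_class) :
  sgp_class := fun S => forall i, F i -> V i S.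

Lemma bigcap_pseudovariety (I : Type) (F : I -> Prop) (V : I -> sgp_class) :
  (forall i, F i -> is_pseudovariety (V i)) ->
  is_pseudovariety (bigcap_class F V).
Proof.
move=> pvV; split=> [S T f injf VS i Fi | S T f sf VS i Fi | J S VS i Fi].
- exact: pv_sub (pvV i Fi) _ _ f injf (VS i Fi).
- exact: pv_img (pvV i Fi) _ _ f sf (VS i Fi).
- by apply: (pv_prod (pvV i Fi)) => j; exact: VS.
Qed.

Definition trivial_class : sgp_class := fun S => #|S| <= 1.

Definition Max (V : pseudovariety) : complexFunctor :=
  cf_join (fun C => class_le V (Fix C)).

(* Main.v *)
From HB Require Import structures.
From mathcomp Require Import all_boot.
Require Import Defs.

(** Every complex contains the singletons, so a semigroup [S] lies in [Fix C]
    exactly when each member of [C S] is a singleton ([FixP]).  The three closure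
    properties of a pseudovariety transport this along homomorphisms: a member of
    the complex of a subsemigroup or of a product has singleton image under the
    embedding or under every projection, and these maps separate points
    ([FixC_jointly_injective]); a member of the complex of a quotient lifts to a
    singleton because [C] preserves surjections ([FixC_img]).

    For the Galois connection, joins of complex functors are pointwise and the
    singletons form a complex, so the join of functors with trivial value at [S]
    again has trivial value at [S] ([Fix_join]).  Hence [V] is contained in
    [Fix (Max V)], and the rest follows from antitonicity and the universal
    property of the join. *)

Set Implicit Arguments.
Unset Strict Implicit.
Unset Printing Implicit Defensive.

Local Open Scope group_scope.

Lemma FixP (C : complexFunctor) (S : finSemigroupType) :
  Fix C S <-> C S \subset sing S.
Proof.
split=> [->|CS]; first exact: subxx.
by apply/eqP; rewrite eqEsubset CS; exact: cf_sing_le.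
Qed.

Section Projection.
Variables (I : finType) (S : I -> finSemigroupType) (i : I).

Definition prod_proj (f : prod_sgp S) : S i := f i.

Lemma prod_projM : {morph prod_proj : f g / f * g}.
Proof. by move=> f g; rewrite /prod_proj ffunE. Qed.

HB.instance Definition _ := isMultiplicative.Build _ _ prod_proj prod_projM.
End Projection.

(** Covers subsemigroups (one injective map) and products (the projections) at
    once.  The members of [C T] are non-empty, so it is enough that any two
    elements of one coincide. *)
Lemma FixC_jointly_injective (C : complexFunctor) (I : Type)
    (S : I -> finSemigroupType) (T : finSemigroupType)
    (f : forall i, {multiplicative T -> S i}) :
  (forall x y, (forall i, f i x = f i y) -> x = y) ->
  (forall i, Fix C (S i)) -> Fix C T.
Proof.
move=> injf FS; apply/FixP/subsetP => X CX.
have /set0Pn[x Xx] : X != set0.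
  by have := subsetP (cf_le_pow C T) _ CX; rewrite inE.
suff -> : X = [set x] by apply: imset_f.
apply/setP => y; rewrite inE; apply/idP/eqP => [Xy|-> //].
apply: injf => i; have := cf_imset (f i) CX; rewrite (FS i).
case/imsetP=> a _ fX.
have fXa z : z \in X -> f i z = a.
  by move=> Xz; apply/set1P; rewrite -fX imset_f.
by rewrite !fXa.
Qed.

Lemma FixC_img (C : complexFunctor) (S T : finSemigroupType)
    (f : {multiplicative S -> T}) : surj f -> Fix C S -> Fix C T.
Proof.
move=> sf FS; apply/FixP/subsetP => Y /(cf_imset_surj sf)[X CX <-].
by apply: sing_map; rewrite -FS.
Qed.

Lemma Fix_pseudovariety (C : complexFunctor) : is_pseudovariety (Fix C).
Proof.
split=> [S T f injf FS | S T f | I S FS]; last 2 first.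
- exact: FixC_img.
- apply: (@FixC_jointly_injective C I S _ (fun i => @prod_proj I S i)) => //.
  by move=> x y xy; apply/ffunP => i; apply: xy.
- apply: (@FixC_jointly_injective C unit (fun=> S) T (fun=> f)) => //.
  by move=> x y /(_ tt)/injf.
Qed.

Lemma Fix_antitone (C1 C2 : complexFunctor) :
  cf_le C1 C2 -> class_le (Fix C2) (Fix C1).
Proof. by move=> le12 S F2; apply/FixP; rewrite -F2; exact: le12. Qed.

(** From right to left it matters that joins are pointwise: [sing S] is an upper
    bound of the values at [S] in the lattice of [S]-complexes. *)
Lemma Fix_join (F : complexFunctor -> Prop) (S : finSemigroupType) :
  Fix (cf_join F) S <-> bigcap_class F Fix S.
Proof.
split=> [FS C FC | FS]; first exact: Fix_antitone (cf_join_ub FC) _ FS.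
apply/FixP; apply: (@scomplex_join_le S _ (SComplex (sing_complex S))).
by move=> _ [C FC <-]; apply/FixP/FS.
Qed.

Lemma Fix_pow (S : finSemigroupType) : Fix cf_pow S <-> trivial_class S.
Proof.
split=> [FS | S1].
- rewrite /trivial_class -cardsT; have [->|S0] := eqVneq [set: S] set0.
    by rewrite cards0.
  have : [set: S] \in sing S by rewrite -FS inE.
  by case/imsetP=> x _ ->; rewrite cards1.
- apply/FixP/subsetP => X; rewrite inE => X0.
  have /cards1P[x ->] : #|X| == 1%N.
    by rewrite eqn_leq card_gt0 X0 (leq_trans (max_card _) S1).
  exact: imset_f.
Qed.

Lemma sub_Fix_Max (V : pseudovariety) : class_le V (Fix (Max V)).
Proof. by move=> S VS; apply/Fix_join => C; apply. Qed.

Lemma Max_galois (C : complexFunctor) (V : pseudovariety) :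
  cf_le C (Max V) <-> class_le V (Fix C).
Proof.
split=> [leC S VS | VC]; last exact: cf_join_ub.
exact: Fix_antitone leC _ (sub_Fix_Max VS).
Qed.

Theorem mainTheorem1 :
  (forall C : complexFunctor, is_pseudovariety (Fix C))
  /\ ((forall C1 C2 : complexFunctor,
         cf_le C1 C2 -> class_le (Fix C2) (Fix C1))
      /\ (forall (F : complexFunctor -> Prop) (S : finSemigroupType),
            Fix (cf_join F) S <-> bigcap_class F Fix S)
      /\ (forall S : finSemigroupType, Fix cf_pow S <-> trivial_class S)
      /\ (forall S : finSemigroupType, Fix cf_sing S))
  /\ ((forall V W : pseudovariety,
         class_le V W -> cf_le (Max W) (Max V))
      /\ (forall (C : complexFunctor) (V : pseudovariety),
            cf_le C (Max V) <-> class_le V (Fix C))).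
Proof.
split; first exact: Fix_pseudovariety.
split.
  split; first exact: Fix_antitone.
  split; first exact: Fix_join.
  by split; first exact: Fix_pow.
split=> [V W VW|]; last exact: Max_galois.
by apply/Max_galois => S /VW; apply: sub_Fix_Max.
Qed.
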